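(* Let $N\in\mathbb{N}$, $a\ge0$, $b>0$, and put $\alpha:=a+b-1$, $\beta:=b-1$. For $\kappa>0$ let $\tilde X_\kappa$ be a random variable with values in the trigonometric alcove $\tilde A:=\{t\in\mathbb{R}^N:\ \frac{\pi}{2}\ge t_1\ge\dots\ge t_N\ge 0\}$ whose distribution $\tilde\mu_\kappa$ has Lebesgue density $$\tilde c_\kappa\prod_{1\le i<j\le N}\bigl(\cos(2t_j)-\cos(2t_i)\bigr)^{\kappa}\prod_{i=1}^N\sin(t_i)^{\kappa a}\sin(2t_i)^{\kappa b}$$ on $\tilde A$, with normalizing constant $\tilde c_\kappa>0$. Let $z_1\le\dots\le z_N$ be the ordered zeros of the Jacobi polynomial $P_N^{(\alpha,\beta)}$. Then, as $\kappa\to\infty$, $\tilde X_\kappa$ converges in probability to $\bigl(\tfrac12\arccos z_1,\dots,\tfrac12\arccos z_N\bigr)$.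
   Context: For $\alpha,\beta>-1$, $P_N^{(\alpha,\beta)}$ denotes the classical Jacobi polynomial of degree $N$, orthogonal on $]-1,1[$ with respect to the weight $(1-x)^\alpha(1+x)^\beta$; its $N$ zeros are simple and lie in $]-1,1[$. *)

(* Defs.v *)
From HB Require Import structures.
From mathcomp Require Import all_boot all_order all_algebra.
From mathcomp Require Import all_classical all_reals all_analysis.
Set Implicit Arguments. Unset Strict Implicit. Unset Printing Implicit Defensive.
Import Order.TTheory GRing.Theory Num.Theory.
Import numFieldNormedType.Exports.
Local Open Scope classical_set_scope.
Local Open Scope ring_scope.

Definition gbinom {R : realType} (r : R) (k : nat) : R :=
  (\prod_(i < k) (r - i%:R)) / (k`!)%:R.

(* Jacobi polynomial P_n^{(al,be)} (explicit formula, DLMF 18.5.8):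
   sum_s binom(n+al, n-s) binom(n+be, s) ((x-1)/2)^s ((x+1)/2)^(n-s) *)
Definition jacobiP {R : realType} (n : nat) (al be : R) : {poly R} :=
  \sum_(s < n.+1)
     (gbinom (n%:R + al) (n - s) * gbinom (n%:R + be) s) *:
     ((2^-1 *: ('X - 1)) ^+ s * (2^-1 *: ('X + 1)) ^+ (n - s)).

(* points of R^N are represented as sequences t = [:: t_1; ...; t_N]
   (0-indexed: t_i is  nth 0 t (i-1)) *)

Fixpoint iint {R : realType} (n : nat) (f : seq R -> \bar R) : \bar R :=
  match n with
  | 0 => f [::]
  | n'.+1 => (\int[@lebesgue_measure R]_(x in setT) iint n' (fun s => f (x :: s)))%E
  end.

Definition trig_alcove {R : realType} (N : nat) : set (seq R) :=
  [set t | size t = N /\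
     (forall i, (i < N)%N -> 0 <= nth 0 t i <= pi / 2) /\
     (forall i j, (i <= j)%N -> (j < N)%N -> nth 0 t j <= nth 0 t i)].

Definition trig_density {R : realType} (N : nat) (a b kappa : R) (t : seq R) : R :=
  (\prod_(j < N) \prod_(i < j)
      powR (cos (2 * nth 0 t j) - cos (2 * nth 0 t i)) kappa) *
  \prod_(i < N) (powR (sin (nth 0 t i)) (kappa * a) *
                 powR (sin (2 * nth 0 t i)) (kappa * b)).

Definition trig_law {R : realType} (N : nat) (a b c kappa : R) (E : set (seq R))
  : \bar R :=
  ((c%:E) * iint N (fun t => if `[< trig_alcove N t /\ E t >]
                             then (trig_density N a b kappa t)%:E else 0%E))%E.

(* Main.v *)
Require Import Defs.
From HB Require Import structures.
From mathcomp Require Import all_boot all_order all_algebra.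
From mathcomp Require Import all_classical all_reals all_analysis.
From mathcomp Require Import ring lra.
Import Order.TTheory GRing.Theory Num.Theory.
Import numFieldNormedType.Exports.
Local Open Scope classical_set_scope.
Local Open Scope ring_scope.
Set Implicit Arguments. Unset Strict Implicit. Unset Printing Implicit Defensive.

(* In the variables [x_i = cos (2 t_i)] the density is the [kappa]-th power of
   [W x = prod_(i<j) (x_j - x_i) * prod_i (1 - x_i)^((a+b)/2) (1 + x_i)^(b/2)]
   up to a constant factor. By the Jacobi differential equation the zeros [z]
   satisfy Stieltjes' relations, i.e. [z] is a critical point of [ln W]. Since
   [W] is a product of powers of affine forms, applying [r <= expR (r - 1)] to
   the ratio [r] of the values of each form at [x] and at [z] gives [W x <= W z],
   and a second-order version of that inequality for the forms [1 + x_i] gives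
   [W x <= expR (- l) * W z] with [l > 0] as soon as [x] is away from [z]. On a
   small box around [z] one has [W x >= expR (- l / 2) * W z], so the law of the
   complement of a neighbourhood of [z] is [O(expR (- kappa * l / 2))]. *)

(** * Positivity of the coefficients and location of the zeros *)

Lemma gbinom_gt0 (R : realType) (r : R) (k n : nat) :
  -1 < r -> (k <= n)%N -> 0 < gbinom (n%:R + r) k.
Proof.
move=> r1 kn; rewrite /gbinom divr_gt0 ?ltr0n ?fact_gt0//.
apply: prodr_gt0 => i _.
have : (i.+1%:R : R) <= n%:R by rewrite ler_nat (leq_trans _ kn).
by rewrite -natr1; lra.
Qed.

Lemma gbinomS (R : realType) (r : R) (k : nat) :
  k.+1%:R * gbinom r k.+1 = (r - k%:R) * gbinom r k.
Proof.
rewrite /gbinom big_ord_recr/= factS natrM invfM.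
have k0 : k.+1%:R != 0 :> R by rewrite pnatr_eq0.
have kf : k`!%:R != 0 :> R by rewrite pnatr_eq0 -lt0n fact_gt0.
by move: k.+1%:R k`!%:R k0 kf => K F K0 F0; field; rewrite F0 K0.
Qed.

Lemma horner_jacobiP (R : realType) (n : nat) (al be x : R) :
  (jacobiP n al be).[x] = \sum_(s < n.+1)
     (gbinom (n%:R + al) (n - s) * gbinom (n%:R + be) s) *
     (((x - 1) / 2) ^+ s * ((x + 1) / 2) ^+ (n - s)).
Proof.
rewrite /jacobiP horner_sum; apply: eq_bigr => s _.
rewrite hornerZ hornerM !horner_exp !hornerZ !hornerE.
by rewrite ![2^-1 * _]mulrC.
Qed.

(** The coefficients of the explicit formula are positive. For [x >= 1] its terms are nonnegative
    and the one with [s = 0] is positive. For [x <= -1] multiplication by [(-1) ^+ n] changes the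
    sign of both bases, and the term [s = n] is positive. *)
Lemma root_jacobiP_itv (R : realType) (n : nat) (al be x : R) :
  -1 < al -> -1 < be -> root (jacobiP n al be) x -> -1 < x < 1.
Proof.
move=> al1 be1; apply: contraTT => xP; rewrite rootE horner_jacobiP.
have A0 (s : 'I_n.+1) :
    0 < gbinom (n%:R + al) (n - s) * gbinom (n%:R + be) s.
  by rewrite mulr_gt0// gbinom_gt0// ?leq_subr// -ltnS.
have [x1|x1] := leP 1 x.
  rewrite big_ord_recl/= gt_eqF// ltr_pwDl//.
    by rewrite mulr_gt0 ?(A0 ord0)// expr0 mul1r exprn_gt0//; lra.
  apply: sumr_ge0 => i _; apply: mulr_ge0; first exact: ltW (A0 (lift ord0 i)).
  by rewrite mulr_ge0// exprn_ge0//; lra.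
have {xP}x1' : x <= -1 by move: xP; rewrite x1 andbT -leNgt.
rewrite -[_ == 0]orFb -(signr_eq0 R n) -mulf_eq0 big_distrr/=.
have sgn A u v (s : 'I_n.+1) : (-1) ^+ n * (A * (u ^+ s * v ^+ (n - s))) =
    A * ((- u) ^+ s * (- v) ^+ (n - s)) :> R.
  have sn : (s <= n)%N by rewrite -ltnS.
  rewrite (exprNn u) (exprNn v) mulrACA -exprD subnKC//.
  by rewrite [LHS]mulrCA.
under eq_bigr do rewrite sgn.
rewrite big_ord_recr/= gt_eqF// ltr_pwDr//.
  by rewrite mulr_gt0 ?(A0 ord_max)// subnn expr0 mulr1 exprn_gt0//; lra.
apply: sumr_ge0 => i _; apply: mulr_ge0.
  exact: ltW (A0 (widen_ord (leqnSn _) i)).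
by rewrite mulr_ge0// exprn_ge0//; lra.
Qed.

Lemma jacobiP_neq0 (R : realType) (n : nat) (al be : R) :
  -1 < al -> -1 < be -> jacobiP n al be != 0.
Proof.
move=> al1 be1; apply/eqP => p0.
have /(root_jacobiP_itv al1 be1) : root (jacobiP n al be) 1 by rewrite p0 root0.
by rewrite ltxx andbF.
Qed.

Lemma size_jacobiP (R : realType) (n : nat) (al be : R) :
  (size (jacobiP n al be) <= n.+1)%N.
Proof.
rewrite (leq_trans (size_sum _ _ _))//; apply/bigmax_leqP => s _.
rewrite (leq_trans (size_scale_leq _ _))// (leq_trans (size_polyMleq _ _))//.
have le1 (p : {poly R}) m : (size p <= 2)%N -> (size (p ^+ m) <= m.+1)%N.
  move=> p2; rewrite (leq_trans (size_poly_exp_leq _ _))// ltnS.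
  by rewrite -[leqRHS]mul1n leq_mul//; case: (size p) p2.
have u2 : (size (2^-1 *: ('X - 1) : {poly R})%R <= 2)%N.
  by rewrite (leq_trans (size_scale_leq _ _))// -polyC1 size_XsubC.
have v2 : (size (2^-1 *: ('X + 1) : {poly R})%R <= 2)%N.
  by rewrite (leq_trans (size_scale_leq _ _))// -polyC1 size_XaddC.
have := leq_add (le1 _ s u2) (le1 _ (n - s)%N v2).
have sn : (s <= n)%N by rewrite -ltnS.
rewrite addSn addnS subnKC//.
by case: (_ + _)%N.
Qed.

(** * The Jacobi differential equation *)

Lemma deriv_exp_scale_XaddC (R : realType) (h e : R) (n : nat) :
  ((h *: ('X + e%:P)) ^+ n)^`() = (h * n%:R) *: (h *: ('X + e%:P)) ^+ n.-1.
Proof.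
rewrite deriv_exp derivZ derivD derivX derivC addr0 alg_polyC.
by rewrite mul_polyC -scaler_nat scalerA mulrC.
Qed.

(** The Jacobi operator sends each product of the explicit formula to a difference of two products
    of total degree [n - 1], which prepares a telescoping sum. *)
Lemma jacobi_ode_term (R : realType) (al be x : R) (s m : nat) :
  let n := (s + m)%N in
  let T := (2^-1 *: ('X - 1)) ^+ s * (2^-1 *: ('X + 1)) ^+ m : {poly R} in
  (1 - x ^+ 2) * T^`()^`().[x] + (be - al - (al + be + 2) * x) * T^`().[x]
    + n%:R * (n%:R + al + be + 1) * T.[x] =
  m%:R * (m%:R + be) * ((x - 1) / 2) ^+ s * ((x + 1) / 2) ^+ m.-1
  - s%:R * (s%:R + al) * ((x - 1) / 2) ^+ s.-1 * ((x + 1) / 2) ^+ m.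
Proof.
move=> n T; rewrite {}/T {}/n -polyC1 -polyCN.
rewrite !(derivM, derivD, derivZ, deriv_exp_scale_XaddC).
rewrite !(hornerD, hornerM, hornerZ, hornerX, hornerC, horner_exp) natrD.
rewrite -!(mulrC 2^-1).
(* In the variable [U = (x - 1) / 2] both bases are polynomials, [U] and [U + 1]. *)
have [U [-> -> ->]] : exists U, [/\ x = 2 * U + 1, 2^-1 * (x - 1) = U & 2^-1 * (x + 1) = U + 1].
  by exists (2^-1 * (x - 1)); split=> //; by field.
(* Two derivatives lower the exponents by truncated predecessors, so the exponents 0 and 1 are
   separate cases. *)
case: s => [|[|s]]; case: m => [|[|m]]; rewrite /= !(exprS, expr0); by field.
Qed.

Lemma jacobi_ode (R : realType) (n : nat) (al be x : R) :
  let p := jacobiP n al be in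
  (1 - x ^+ 2) * p^`()^`().[x] + (be - al - (al + be + 2) * x) * p^`().[x]
    + n%:R * (n%:R + al + be + 1) * p.[x] = 0.
Proof.
move=> p; rewrite {}/p /jacobiP !linear_sum !horner_sum !big_distrr -!big_split/=.
under eq_bigr => s _.
  have sn : (s <= n)%N by rewrite -ltnS.
  rewrite !derivZ !hornerZ !(mulrCA _ (gbinom _ _ * gbinom _ _)) -!mulrDr.
  have := jacobi_ode_term al be x s (n - s); rewrite /= subnKC// => ->.
  rewrite mulrBr; over.
(* The first sum loses its last term (factor [n - s = 0]) and the second its first (factor [s = 0]).
   After the shift by one both carry the same products, and [gbinomS] matches the coefficients. *)
rewrite sumrB big_ord_recr big_ord_recl/= subnn !mul0r !mulr0 addr0 add0r.
rewrite -sumrB big1// => i _.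
rewrite /bump add1n add0n -subnS.
have := gbinomS (n%:R + al) (n - i.+1); rewrite subnSK// => e1.
have e2 := gbinomS (n%:R + be) i.
have n1 : n%:R + al - (n - i.+1)%:R = i.+1%:R + al by rewrite natrB//; ring.
have n2 : n%:R + be - i%:R = (n - i)%:R + be by rewrite natrB 1?ltnW//; ring.
rewrite {}n1 in e1; rewrite {}n2 in e2.
move: (gbinom _ (n - i)) (gbinom _ i) (gbinom _ i.+1) (gbinom _ (n - i.+1)) e1 e2
  => G1 G2 G2' G1' e1 e2.
set U := (_ ^+ i); set V := (_ ^+ (n - i.+1)).
transitivity (((n - i)%:R * G1) * (((n - i)%:R + be) * G2) * (U * V)
   - ((i.+1%:R + al) * G1') * (i.+1%:R * G2') * (U * V)).
  by ring.
by rewrite e1 e2 subrr.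
Qed.

(** * Stieltjes' relations for the zeros *)

Lemma deriv_prod_XsubC (R : fieldType) (I : Type) (r : seq I) (P : pred I)
    (F : I -> R) (x : R) : (forall i, P i -> x != F i) ->
  (\prod_(i <- r | P i) ('X - (F i)%:P))^`().[x] =
  (\prod_(i <- r | P i) (x - F i)) * \sum_(i <- r | P i) (x - F i)^-1.
Proof.
move=> xF; elim: r => [|i r IH]; first by rewrite !big_nil derivC horner0 mulr0.
rewrite !big_cons; case: ifPn => // Pi; rewrite derivM hornerD !hornerM IH.
rewrite derivXsubC hornerC hornerXsubC horner_prod mul1r.
under eq_bigr do rewrite hornerXsubC.
have := xF _ Pi; rewrite -subr_eq0 => x0.
by rewrite mulrDr mulrAC mulfV// mul1r mulrA.
Qed.

(* The term [j = i] of the sum is [0^-1 = 0]. *)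
Lemma stieltjes (R : realType) (n : nat) (al be : R) (z : seq R) (i : nat) :
  -1 < al -> -1 < be -> size z = n -> uniq z -> all (root (jacobiP n al be)) z ->
  (i < n)%N ->
  \sum_(j < n) (nth 0 z i - nth 0 z j)^-1 =
  (al + 1) / 2 / (1 - nth 0 z i) - (be + 1) / 2 / (1 + nth 0 z i).
Proof.
move=> al1 be1 zn uz rz i_n; set p := jacobiP n al be in rz *.
have p0 : p != 0 by exact: jacobiP_neq0.
(* [size_jacobiP] bounds the degree from above; the distinct roots of the nonzero [p] bound it from
   below. *)
have sp : size p = (size z).+1.
  by apply/eqP; rewrite eqn_leq max_poly_roots// zn size_jacobiP.
have /andP[zi1 zi2] : -1 < nth 0 z i < 1.
  by apply: (@root_jacobiP_itv _ n al be) => //; apply: (all_nthP 0 rz); rewrite zn.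
have := all_roots_prod_XsubC sp rz; rewrite uniq_rootsE => /(_ uz).
have c0 : lead_coef p != 0 by rewrite lead_coef_eq0.
move: (lead_coef p) c0 => c c0 pE.
set x := nth 0 z i in zi1 zi2 *.
have -> : \sum_(j < n) (x - nth 0 z j)^-1 = \sum_(y <- z | y != x) (x - y)^-1.
  transitivity (\sum_(y <- z) (x - y)^-1); first by rewrite (big_nth 0) big_mkord zn.
  rewrite (bigID (fun y => y != x))/=.
  rewrite [X in _ + X]big1 ?addr0// => y /negPn/eqP ->; by rewrite subrr invr0.
set S := \sum_(y <- z | _) _.
set g := c *: \prod_(y <- z | y != x) ('X - y%:P).
have {}pE : p = ('X - x%:P) * g.
  rewrite pE /g -scalerAr; congr (_ *: _).
  rewrite (bigD1_seq x)//=; apply: mem_nth; by rewrite zn.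
have g0 : g.[x] != 0.
  rewrite hornerZ horner_prod mulf_neq0// prodf_seq_neq0; apply/allP => y _.
  by apply/implyP => yx; rewrite hornerXsubC subr_eq0 eq_sym.
have gS : g^`().[x] = g.[x] * S.
  rewrite /g derivZ !hornerZ deriv_prod_XsubC => [|y]; last by rewrite eq_sym.
  rewrite horner_prod mulrA; congr (_ * _ * _).
  by apply: eq_bigr => y _; rewrite hornerXsubC.
have := jacobi_ode n al be x; rewrite /= -/p pE.
rewrite derivM derivXsubC mul1r derivD derivM derivXsubC mul1r.
rewrite hornerM hornerXsubC !hornerD !hornerM hornerXsubC subrr gS => e.
have {e} : g.[x] * (2 * (1 - x ^+ 2) * S + (be - al - (al + be + 2) * x)) = 0.
  by rewrite -[RHS]e; ring.
move=> /eqP; rewrite mulf_eq0 (negPf g0)/= => /eqP e.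
have x1 : 1 - x != 0 by rewrite subr_eq0 gt_eqF.
have x2 : 1 + x != 0 by rewrite gt_eqF//; lra.
apply: (@mulfI _ (2 * (1 - x ^+ 2))).
  have -> : 1 - x ^+ 2 = (1 - x) * (1 + x) by ring.
  by rewrite !mulf_neq0.
have -> : 2 * (1 - x ^+ 2) * S = - (be - al - (al + be + 2) * x) by lra.
by field; rewrite x1 x2.
Qed.

(** * Exponential bounds for products and real powers *)

Lemma powR_prod (R : realType) (I : Type) (r : seq I) (P : pred I) (F : I -> R) (k : R) :
  (forall i, P i -> 0 <= F i) ->
  (\prod_(i <- r | P i) F i) `^ k = \prod_(i <- r | P i) F i `^ k.
Proof.
move=> F0; elim: r => [|i r IH]; first by rewrite !big_nil powR1.
rewrite !big_cons; case: ifPn => // Pi; rewrite powRM ?IH ?F0//.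
exact: prodr_ge0.
Qed.

Lemma prod_le_expR (R : realType) (I : Type) (r : seq I) (P : pred I)
    (F G e : I -> R) :
  (forall i, P i -> 0 <= F i <= G i * expR (e i)) ->
  \prod_(i <- r | P i) F i <=
  \prod_(i <- r | P i) G i * expR (\sum_(i <- r | P i) e i).
Proof. by move=> FG; rewrite expR_sum -big_split/=; exact: ler_prod. Qed.

Lemma prod_ge_expR (R : realType) (I : Type) (r : seq I) (P : pred I)
    (F G e : I -> R) :
  (forall i, P i -> 0 <= G i /\ G i * expR (e i) <= F i) ->
  \prod_(i <- r | P i) G i * expR (\sum_(i <- r | P i) e i) <=
  \prod_(i <- r | P i) F i.
Proof.
move=> FG; rewrite expR_sum -big_split/=; apply: ler_prod => i /FG[G0 GF].
by rewrite mulr_ge0 ?expR_ge0.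
Qed.

Lemma powR_le_expR (R : realType) (w y z e : R) :
  0 <= w -> 0 <= y -> 0 <= z -> y <= z * expR e ->
  y `^ w <= z `^ w * expR (w * e).
Proof.
move=> w0 y0 z0 yz; rewrite [w * e]mulrC expRM -powRM ?expR_ge0//.
by apply: ge0_ler_powR => //; rewrite nnegrE ?mulr_ge0 ?expR_ge0.
Qed.

Lemma powR_ge_expR (R : realType) (w y z e : R) :
  0 <= w -> 0 <= z -> z * expR e <= y -> z `^ w * expR (w * e) <= y `^ w.
Proof.
move=> w0 z0 yz; rewrite [w * e]mulrC expRM -powRM ?expR_ge0//.
have ze0 : 0 <= z * expR e by rewrite mulr_ge0 ?expR_ge0.
by apply: ge0_ler_powR => //; rewrite nnegrE// (le_trans ze0).
Qed.

Lemma le_expR_ratio (R : realType) (y z : R) : 0 < z -> y <= z * expR (y / z - 1).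
Proof.
move=> z0; rewrite -ler_pdivrMl// mulrC (le_trans _ (expR_ge1Dx _))//.
by rewrite addrC subrK.
Qed.

(* Improves [1 + y <= expR y], with [y = (x - z) / (1 + z)], to
   [(1 + y / 2) ^+ 2 <= expR y]; the constant comes from [(1 + x) (1 + z) <= 4]. *)
Lemma le_expR_ratio_gap (R : realType) (x z : R) : -1 <= x <= 1 -> -1 < z < 1 ->
  1 + x <= (1 + z) * expR ((1 + x) / (1 + z) - 1 - ln (1 + (x - z) ^+ 2 / 16)).
Proof.
move=> /andP[x1 x2] /andP[z1 z2].
have q0 : 0 < 1 + (x - z) ^+ 2 / 16.
  by rewrite ltr_pwDl// divr_ge0// sqr_ge0.
have z0 : 0 < 1 + z by lra.
rewrite expRB lnK ?posrE// mulrA ler_pdivlMr//.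
set y := (x - z) / (1 + z).
have -> : (1 + x) / (1 + z) - 1 = y.
  by rewrite /y; field; rewrite gt_eqF.
have y2 : 0 <= 1 + y / 2.
  have : -1 <= y by rewrite /y ler_pdivlMr//; lra.
  by lra.
have ye : (1 + y / 2) ^+ 2 <= expR y.
  rewrite [y in leRHS]splitr expRD -expr2 lerXn2r ?nnegrE ?expR_ge0//.
  exact: expR_ge1Dx.
apply: (@le_trans _ _ ((1 + z) * (1 + y / 2) ^+ 2)); last by rewrite ler_pM2l.
have -> : (1 + z) * (1 + y / 2) ^+ 2 = 1 + x + (x - z) ^+ 2 / (4 * (1 + z)).
  by rewrite /y; field; rewrite gt_eqF.
rewrite mulrDr mulr1 lerD2l mulrCA ler_wpM2l ?sqr_ge0//.
have xz4 : (1 + x) * (1 + z) <= 2 * 2 by apply: ler_pM; lra.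
by rewrite invfM ler_pdivlMr//; lra.
Qed.

(** * Bounds for the weight in the cosine variables *)

(** Regroups a sum over pairs into full rows, the form in which Stieltjes' relations apply. *)
Lemma sum_triangle (R : realType) (n : nat) (f : nat -> nat -> R) :
  (forall i, f i i = 0) ->
  \sum_(j < n) \sum_(i < j) (f j i + f i j) = \sum_(j < n) \sum_(i < n) f j i.
Proof.
move=> f0; elim: n => [|n IH]; first by rewrite !big_ord0.
rewrite !big_ord_recr/= IH.
under [in RHS]eq_bigr do rewrite big_ord_recr/=.
by rewrite !big_split/= f0 addr0 -!addrA; congr (_ + _); rewrite addrC.
Qed.

(** The [W] of the overview, normalized so that its [kappa]-th power is the density itself: with
    [x i = cos (2 * t_i)] one has [(1 - x i) / 2 = sin t_i ^+ 2] and [(1 - x i) * (1 + x i) = sin (2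
    * t_i) ^+ 2], whence the halved exponents. *)
Definition jacobi_weight (R : realType) (n : nat) (a b : R) (x : nat -> R) : R :=
  (\prod_(j < n) \prod_(i < j) (x j - x i)) *
  \prod_(i < n) (((1 - x i) / 2) `^ (a / 2) *
                 ((1 - x i) `^ (b / 2) * (1 + x i) `^ (b / 2))).

Lemma jacobi_weight_ge0 (R : realType) (n : nat) (a b : R) (x : nat -> R) :
  (forall i j, (i < j)%N -> (j < n)%N -> x i <= x j) -> 0 <= jacobi_weight n a b x.
Proof.
move=> xx; apply: mulr_ge0; apply: prodr_ge0 => i _.
  by apply: prodr_ge0 => j _; rewrite subr_ge0 xx.
by rewrite !mulr_ge0 ?powR_ge0.
Qed.

Lemma jacobi_weight_gt0 (R : realType) (n : nat) (a b : R) (z : nat -> R) :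
  (forall i, (i < n)%N -> -1 < z i < 1) ->
  (forall i j, (i < j)%N -> (j < n)%N -> z i < z j) ->
  0 < jacobi_weight n a b z.
Proof.
move=> z1 zz; apply: mulr_gt0; apply: prodr_gt0 => i _.
  by apply: prodr_gt0 => j _; rewrite subr_gt0 zz.
by have /andP[? ?] := z1 _ (ltn_ord i); rewrite !mulr_gt0// powR_gt0//; lra.
Qed.

(* Every factor of the weight is a power of an affine form, and each ratio [r]
   of such forms satisfies [r <= expR (r - 1)]. The exponents add up to the
   derivative at [z] of the logarithm of the weight in the direction [x - z],
   which vanishes. *)
Lemma jacobi_weight_le (R : realType) (n : nat) (a b : R) (x z : nat -> R) :
  0 <= a -> 0 <= b ->
  (forall i, (i < n)%N -> -1 < z i < 1) ->
  (forall i j, (i < j)%N -> (j < n)%N -> z i < z j) ->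
  (forall i, (i < n)%N -> \sum_(j < n) (z i - z j)^-1 =
     (a + b) / 2 / (1 - z i) - b / 2 / (1 + z i)) ->
  (forall i, (i < n)%N -> -1 <= x i <= 1) ->
  (forall i j, (i < j)%N -> (j < n)%N -> x i <= x j) ->
  jacobi_weight n a b x <= jacobi_weight n a b z *
    expR (- \sum_(i < n) b / 2 * ln (1 + (x i - z i) ^+ 2 / 16)).
Proof.
move=> a0 b0 z1 zz zS x1 xx.
(* [e1] and [e2] collect the first-order exponents of the differences and of the boundary factors;
   [q] is the second-order gain. *)
pose e1 j := \sum_(i < j) ((x j - x i) / (z j - z i) - 1).
pose e2 i := a / 2 * ((1 - x i) / (1 - z i) - 1) +
  (b / 2 * ((1 - x i) / (1 - z i) - 1) + b / 2 * ((1 + x i) / (1 + z i) - 1)).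
pose q i := b / 2 * ln (1 + (x i - z i) ^+ 2 / 16).
have e0 : \sum_(j < n) e1 j + \sum_(i < n) e2 i = 0.
  (* The numerator minus the denominator is [(x j - z j) - (x i - z i)], so each pair splits into
     the two orders of a single function of [j] and [i]. *)
  rewrite (eq_bigr (fun j : 'I_n => \sum_(i < j) ((x j - z j) * (z j - z i)^-1 +
      (x i - z i) * (z i - z j)^-1))); last first.
    move=> j _; apply: eq_bigr => i _; rewrite -(opprB (z j) (z i)) invrN.
    have : z j - z i != 0 by rewrite subr_eq0 gt_eqF// zz.
    by move=> ?; field.
  rewrite (sum_triangle n (f := fun j i => (x j - z j) * (z j - z i)^-1)); last first.
    by move=> i; rewrite subrr invr0 mulr0.
  rewrite -big_split/= big1// => i _; rewrite -big_distrr/= zS// /e2.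
  have /andP[? ?] := z1 _ (ltn_ord i).
  have h1 : 1 - z i != 0 by rewrite gt_eqF//; lra.
  have h2 : 1 + z i != 0 by rewrite gt_eqF//; lra.
  by field; rewrite h1 h2.
have -> : - \sum_(i < n) b / 2 * ln (1 + (x i - z i) ^+ 2 / 16) =
    \sum_(j < n) e1 j + \sum_(i < n) (e2 i - q i).
  by rewrite sumrB addrA e0 add0r.
rewrite expRD mulrACA; apply: ler_pM.
- by do 2!(apply: prodr_ge0 => ? _); rewrite subr_ge0 xx.
- by apply: prodr_ge0 => ? _; rewrite !mulr_ge0 ?powR_ge0.
- apply: prod_le_expR => j _; apply/andP; split.
    by apply: prodr_ge0 => i _; rewrite subr_ge0 xx.
  apply: prod_le_expR => i _; rewrite subr_ge0 xx//=.
  by apply: le_expR_ratio; rewrite subr_gt0 zz.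
- apply: prod_le_expR => i _; rewrite !mulr_ge0 ?powR_ge0//=.
  have /andP[x1l x1r] := x1 _ (ltn_ord i).
  have /andP[z1l z1r] := z1 _ (ltn_ord i).
  have z1m : 0 < 1 - z i by rewrite subr_gt0.
  have xle := le_expR_ratio (1 - x i) z1m.
  rewrite /e2 -!addrA !expRD mulrACA; apply: ler_pM; rewrite ?powR_ge0 ?mulr_ge0 ?powR_ge0//.
    apply: powR_le_expR; [lra|lra|lra|].
    by rewrite mulrAC ler_pdivrMr// divrK// unitfE.
  rewrite mulrACA -expRD; apply: ler_pM; rewrite ?powR_ge0//.
    by apply: powR_le_expR; lra.
  (* Only the factor [1 + x i] uses the sharper inequality, and it yields the whole gain [q i]. *)
  rewrite /q -mulrBr; apply: powR_le_expR; [lra|lra|lra|].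
  by apply: le_expR_ratio_gap; apply/andP.
Qed.

(** The weight is homogeneous in its affine forms: each pair has degree 1 and each index degree
    [a / 2 + b / 2 + b / 2]. A common factor [expR (- s)] thus comes out to the total degree. *)
Lemma jacobi_weight_ge (R : realType) (n : nat) (a b s : R) (x z : nat -> R) :
  0 <= a -> 0 <= b ->
  (forall i, (i < n)%N -> -1 < z i < 1) ->
  (forall i j, (i < j)%N -> (j < n)%N -> z i < z j) ->
  (forall i, (i < n)%N -> (1 - z i) * expR (- s) <= 1 - x i) ->
  (forall i, (i < n)%N -> (1 + z i) * expR (- s) <= 1 + x i) ->
  (forall i j, (i < j)%N -> (j < n)%N -> (z j - z i) * expR (- s) <= x j - x i) ->
  jacobi_weight n a b z *
    expR (- s * (\sum_(j < n) \sum_(i < j) 1 + \sum_(i < n) (a / 2 + b))) <=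
  jacobi_weight n a b x.
Proof.
move=> a0 b0 z1 zz xm xp xx.
rewrite mulrDr !big_distrr/= expRD mulrACA.
under eq_bigr do rewrite big_distrr/= mulr1.
apply: ler_pM.
- rewrite mulr_ge0 ?expR_ge0//.
  by do 2!(apply: prodr_ge0 => ? _); rewrite subr_ge0 ltW ?zz.
- rewrite mulr_ge0 ?expR_ge0//.
  by apply: prodr_ge0 => ? _; rewrite !mulr_ge0 ?powR_ge0.
- apply: prod_ge_expR => j _; split.
    by apply: prodr_ge0 => i _; rewrite subr_ge0 ltW ?zz.
  by apply: prod_ge_expR => i _; rewrite subr_ge0 ltW ?zz//; split=> //; exact: xx.
- apply: prod_ge_expR => i _; rewrite !mulr_ge0 ?powR_ge0//; split=> //.
  have /andP[z1l z1r] := z1 _ (ltn_ord i).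
  have -> : - s * (a / 2 + b) = a / 2 * - s + (b / 2 * - s + b / 2 * - s) by field.
  rewrite !expRD mulrACA; apply: ler_pM; rewrite ?mulr_ge0 ?powR_ge0 ?expR_ge0//.
    apply: powR_ge_expR; [lra|lra|].
    by rewrite mulrAC ler_pM2r ?xm.
  rewrite mulrACA; apply: ler_pM; rewrite ?mulr_ge0 ?powR_ge0 ?expR_ge0//.
    by apply: powR_ge_expR; [lra|lra|exact: xm].
  by apply: powR_ge_expR; [lra|lra|exact: xp].
Qed.

(** * Comparison of iterated integrals and the volume of a cube *)

Section iterated_integral.
Local Open Scope ereal_scope.

(* No measurability is needed: the integral of a nonnegative function is
   a supremum over the simple functions below it. *)
Lemma ge0_le_integralT (d : measure_display) (T : measurableType d) (R : realType)
    (mu : {measure set T -> \bar R}) (f g : T -> \bar R) :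
  (forall x, 0 <= f x) -> (forall x, f x <= g x) ->
  \int[mu]_(x in setT) f x <= \int[mu]_(x in setT) g x.
Proof.
move=> f0 fg; rewrite !ge0_integralTE//; last by move=> x; exact: le_trans (fg x).
apply: ereal_sup_le => _ /= [h hf <-]; exists h => // x.
exact: le_trans (fg x).
Qed.

Lemma iint_ge0 (R : realType) (n : nat) (f : seq R -> \bar R) :
  (forall s, 0 <= f s) -> 0 <= iint n f.
Proof.
elim: n f => [|n IH] f f0 /=; first exact: f0.
by apply: integral_ge0 => x _; exact: IH.
Qed.

Lemma le_iint (R : realType) (n : nat) (f g : seq R -> \bar R) :
  (forall s, 0 <= f s) -> (forall s, size s = n -> f s <= g s) ->
  iint n f <= iint n g.
Proof.
elim: n f g => [|n IH] f g f0 fg /=; first exact: fg.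
apply: ge0_le_integralT => x; first exact: iint_ge0.
by apply: IH => // s sn; apply: fg; rewrite /= sn.
Qed.

Definition in_box (R : realType) (n : nat) (l : nat -> R) (w : R) (s : seq R) : Prop :=
  forall i, (i < n)%N -> (l i <= nth 0 s i <= l i + w)%R.

Lemma iint_box (R : realType) (n : nat) (l : nat -> R) (w k : R) : (0 < w)%R ->
  iint n (fun s => if `[< in_box n l w s >] then k%:E else 0) = (k * w ^+ n)%:E.
Proof.
move=> w0; elim: n l => [|n IH] l /=.
  by rewrite asboolT ?expr0 ?mulr1.
(* As a function of the first coordinate, the inner integral is a constant on the first side of the
   cube and zero elsewhere. *)
have E (x : R) :
    iint n (fun s => if `[< in_box n.+1 l w (x :: s) >] then k%:E else 0) =
    ((cst (k * w ^+ n)%:E) \_ `[l 0%N, (l 0%N + w)%R]) x.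
  rewrite patchE; case: ifPn => [|/negP] xl.
    rewrite -(IH (fun i => l i.+1)); congr iint; apply/funext => s.
    congr (if _ then _ else _); apply: asbool_equiv_eq; split=> [b i i_n|b [_|i i_n]].
    - exact: (b i.+1).
    - by move: xl; rewrite inE /= in_itv.
    - exact: b.
  suff -> : (fun s => if `[< in_box n.+1 l w (x :: s) >] then k%:E else 0) = cst 0.
    by elim: n {IH xl} => //= m ->; rewrite integral0.
  apply/funext => s; rewrite asboolF// => b; apply: xl.
  by rewrite inE /= in_itv; exact: (b 0%N).
under eq_integral do rewrite E.
rewrite -integral_mkcond integral_cst//= lebesgue_measure_itv/= lte_fin ltrDl w0.
by rewrite -EFinB -EFinM addrAC subrr add0r exprSr mulrA.
Qed.

End iterated_integral.

(** * The density and the law in terms of the weight *)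

Lemma powR_sqr_half (R : realType) (y w : R) : 0 <= y -> (y ^+ 2) `^ (w / 2) = y `^ w.
Proof. by move=> y0; rewrite -powR_mulrn// -powRrM mulrC divfK. Qed.

Lemma ler_cos (R : realType) (x y : R) : 0 <= x -> y <= pi -> x <= y -> cos y <= cos x.
Proof.
move=> x0 yp xy; rewrite leNgt ltr_cos ?in_itv/= -?leNgt//.
- by rewrite (le_trans x0).
- by rewrite x0 (le_trans xy).
Qed.

Lemma trig_alcove_cos_le (R : realType) (n : nat) (t : seq R) (i j : nat) :
  trig_alcove n t -> (i < j)%N -> (j < n)%N ->
  cos (2 * nth 0 t i) <= cos (2 * nth 0 t j).
Proof.
move=> [_ [t1 tt]] ij jn.
have /andP[tj0 _] := t1 _ jn; have /andP[_ ti1] := t1 _ (ltn_trans ij jn).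
by have := tt _ _ (ltnW ij) jn; move=> ?; rewrite ler_cos//; lra.
Qed.

(** On the alcove the angles decrease, so their doubled cosines increase and all factors are
    nonnegative; the exponent [k] then factors out of the products. *)
Lemma trig_densityE (R : realType) (n : nat) (a b k : R) (t : seq R) :
  trig_alcove n t ->
  trig_density n a b k t = jacobi_weight n a b (fun i => cos (2 * nth 0 t i)) `^ k.
Proof.
move=> tA; have [tn [t1 _]] := tA.
have x0 (j : 'I_n) (i : 'I_j) : 0 <= cos (2 * nth 0 t j) - cos (2 * nth 0 t i).
  by rewrite subr_ge0 (trig_alcove_cos_le tA).
rewrite /trig_density /jacobi_weight powRM; last 2 first.
- by apply: prodr_ge0 => j _; apply: prodr_ge0 => i _; exact: x0.
- by apply: prodr_ge0 => ? _; rewrite !mulr_ge0 ?powR_ge0.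
rewrite !powR_prod; last 2 first.
- by move=> ? _; rewrite !mulr_ge0 ?powR_ge0.
- by move=> j _; apply: prodr_ge0 => i _; exact: x0.
congr (_ * _).
  by apply: eq_bigr => j _; rewrite powR_prod// => i _; exact: x0.
apply: eq_bigr => i _; have /andP[ti0 ti1] := t1 _ (ltn_ord i).
set u := nth 0 t i in ti0 ti1 *.
have s0 : 0 <= sin u by rewrite sin_ge0_pi// ti0/=; lra.
have s20 : 0 <= sin (2 * u) by rewrite sin_ge0_pi//; apply/andP; split; lra.
have -> : (1 - cos (2 * u)) / 2 = sin u ^+ 2.
  by rewrite mulr_natl cos_mulr2n cos2sin2 -mulr_natl; field.
have c1 := cos_le1 (2 * u); have c2 := cos_geN1 (2 * u).
rewrite -powRM; [|lra|lra].
have -> : (1 - cos (2 * u)) * (1 + cos (2 * u)) = sin (2 * u) ^+ 2.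
  by rewrite sin2cos2; ring.
by rewrite !powR_sqr_half// powRM ?powR_ge0// -!powRrM ![_ * k]mulrC.
Qed.

Lemma trig_density_ge0 (R : realType) (n : nat) (a b k : R) (t : seq R) :
  0 <= trig_density n a b k t.
Proof.
apply: mulr_ge0; apply: prodr_ge0 => i _; last by rewrite mulr_ge0 ?powR_ge0.
by apply: prodr_ge0 => j _; exact: powR_ge0.
Qed.

Lemma trig_law_ge0 (R : realType) (n : nat) (a b c k : R) (E : set (seq R)) :
  0 <= c -> (0 <= trig_law n a b c k E)%E.
Proof.
move=> c0; apply: mule_ge0; first by rewrite lee_fin.
by apply: iint_ge0 => s; case: ifP => // _; rewrite lee_fin trig_density_ge0.
Qed.

(** The alcove lies in the cube with side from 0 to [pi / 2]. *)
Lemma trig_law_le (R : realType) (n : nat) (a b c k M : R) (E : set (seq R)) :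
  0 <= c -> 0 <= M ->
  (forall t, trig_alcove n t -> E t -> trig_density n a b k t <= M) ->
  (trig_law n a b c k E <= (c * (M * (pi / 2) ^+ n))%:E)%E.
Proof.
move=> c0 M0 tM; rewrite EFinM; apply: lee_wpmul2l; first by rewrite lee_fin.
rewrite -(iint_box n (fun=> 0) M (divr_gt0 (pi_gt0 R) _))//.
apply: le_iint => [s|s sn].
  by case: ifP => // _; rewrite lee_fin trig_density_ge0.
case: ifPn => [/asboolP[As Es]|_]; last by case: ifP.
rewrite asboolT ?lee_fin ?tM// => i i_n; rewrite add0r.
by case: As => _ [+ _]; exact.
Qed.

(** Once the total mass is one, this bounds the normalizing constant from above. *)
Lemma trig_law_ge (R : realType) (n : nat) (a b c k m w : R) (l : nat -> R) :
  0 <= c -> 0 <= m -> 0 < w ->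
  (forall t, size t = n -> in_box n l w t ->
     trig_alcove n t /\ m <= trig_density n a b k t) ->
  ((c * (m * w ^+ n))%:E <= trig_law n a b c k setT)%E.
Proof.
move=> c0 m0 w0 tm; rewrite EFinM; apply: lee_wpmul2l; first by rewrite lee_fin.
rewrite -(iint_box n l m w0); apply: le_iint => [s|s sn].
  by case: ifP.
case: ifPn => [/asboolP bs|_].
  by have [As ms] := tm _ sn bs; rewrite asboolT ?lee_fin.
by case: ifP => // _; rewrite lee_fin trig_density_ge0.
Qed.

(** * Neighbourhoods in the angles and in their cosines *)

Lemma near_right_closed_ball (R : realType) (x : R) (P : set R) :
  (\forall t \near x, P t) ->
  \forall e \near (0 : R)^'+, forall t, `|t - x| <= e -> P t.
Proof.
move=> /nbhs_ballP[d /= d0 dP]; apply: filterS (nbhs_right_lt d0) => e ed t te.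
by apply: dP; rewrite /ball/= distrC (le_lt_trans te).
Qed.

Lemma near_cos_double (R : realType) (u r : R) : 0 < r ->
  \forall t \near u, `|cos (2 * t) - cos (2 * u)| <= r.
Proof.
move=> r0.
have /cvgrPdist_le/(_ _ r0) : cos (2 * t) @[t --> u] --> cos (2 * u).
  apply: continuous_comp; last exact: continuous_cos.
  by apply: cvgMl_tmp; exact: cvg_id.
by apply: filterS => t; rewrite distrC.
Qed.

(** By contraposition from the continuity of [acos] at [z], as [acos (cos (2 * t)) = 2 * t] for
    these [t]. *)
Lemma near_acos_gap (R : realType) (z eps : R) : -1 < z < 1 -> 0 < eps ->
  \forall d \near (0 : R)^'+, forall t, 0 <= t <= pi / 2 ->
    eps <= `|t - acos z / 2| -> d <= `|cos (2 * t) - z|.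
Proof.
move=> z1 e0.
have e20 : 0 < 2 * eps by rewrite mulr_gt0.
have /cvgrPdist_lt/(_ _ e20)/near_right_closed_ball := continuous_acos z1.
apply: filterS => d dP t /andP[t0 t1]; apply: contraTT; rewrite -!ltNge => /ltW/dP.
rewrite cosK ?in_itv/=; last by apply/andP; split; lra.
have -> : acos z - 2 * t = - 2 * (t - acos z / 2) by field.
by rewrite normrM normrN normr_nat ltr_pM2l.
Qed.

Lemma ltr_acos (R : realType) (x y : R) : -1 <= x -> y <= 1 -> x < y ->
  acos y < acos x.
Proof.
move=> x1 y1 xy.
have x2 : -1 <= x <= 1 by rewrite x1 (le_trans (ltW xy)).
have y2 : -1 <= y <= 1 by rewrite y1 (le_trans x1 (ltW xy)).
rewrite ltNge; apply/negP => /(ler_cos (acos_ge0 x2) (acos_lepi y2)).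
by rewrite !acosK ?in_itv// leNgt xy.
Qed.

Lemma cvg_expR_EFin (R : realType) (B d : R) : 0 < d ->
  (B * expR (- (k * d)))%:E @[k --> +oo] --> 0%E.
Proof.
move=> d0; apply: cvg_EFin; first exact: nearW.
rewrite -[X in _ --> X](mulr0 B); apply: cvgMl_tmp.
apply: (cvg_comp (fun k => k * d) (fun x => expR (- x))); last exact: cvgr_expR.
exact: gt0_cvgMly d0 cvg_id.
Qed.

(** At the limit point all constraints are strict and finite in number. First a tolerance [r] for
    the cosines is chosen, then a half-side [h] that keeps them within [r] and the angles in the
    alcove. *)
Lemma exists_alcove_box (R : realType) (n : nat) (a b s : R) (z : nat -> R) :
  0 <= a -> 0 <= b -> 0 < s ->
  (forall i, (i < n)%N -> -1 < z i < 1) ->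
  (forall i j, (i < j)%N -> (j < n)%N -> z i < z j) ->
  exists2 h : R, 0 < h & forall t, size t = n ->
    in_box n (fun i => acos (z i) / 2 - h) (2 * h) t ->
    trig_alcove n t /\
    jacobi_weight n a b z *
      expR (- s * (\sum_(j < n) \sum_(i < j) 1 + \sum_(i < n) (a / 2 + b))) <=
    jacobi_weight n a b (fun i => cos (2 * nth 0 t i)).
Proof.
move=> a0 b0 s0 z1 zz; set q := expR (- s).
have q1 : 0 < 1 - q by rewrite subr_gt0 /q expR_lt1 oppr_lt0.
pose th i := acos (z i) / 2.
have th0 (i : 'I_n) : 0 < th i < pi / 2.
  have /andP[z1l z1r] := z1 _ (ltn_ord i).
  have := @acos_gt0 _ (z i); have := @acos_ltpi _ (z i).
  by rewrite (ltW z1l) z1l z1r (ltW z1r) /th => /(_ isT) ? /(_ isT) ?; apply/andP; split; lra.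
have thz (i : 'I_n) : cos (2 * th i) = z i.
  have /andP[z1l z1r] := z1 _ (ltn_ord i).
  by rewrite /th mulrC divfK// acosK// in_itv/= !ltW.
have tht (i j : 'I_n) : (i < j)%N -> th j < th i.
  move=> ij; have /andP[? _] := z1 _ (ltn_ord i); have /andP[_ ?] := z1 _ (ltn_ord j).
  by rewrite /th ltr_pM2r// ltr_acos ?ltW// zz.
(* A form that moves by at most [1 - q] times its value at [z] keeps at least the fraction [q] of
   it; a difference moves by up to [2 * r]. *)
have nearr : \forall r \near (0 : R)^'+, [/\ 0 < r,
    forall i : 'I_n, r <= (1 - z i) * (1 - q) /\ r <= (1 + z i) * (1 - q) &
    forall i j : 'I_n, (i < j)%N -> 2 * r <= (z j - z i) * (1 - q)].
  near=> r; split; first by near: r; exact: nbhs_right_gt.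
    near: r; apply: filter_forall => i.
    have /andP[z1l z1r] := z1 _ (ltn_ord i).
    near=> r; split; near: r; apply: nbhs_right_le; rewrite mulr_gt0//; lra.
  near: r; apply: filter_forall => i; apply: filter_forall => j.
  have [ij|_] := ltnP i j; last exact: nearW.
  have zij : 0 < (z j - z i) * (1 - q) / 2 by rewrite !mulr_gt0// subr_gt0 zz.
  by apply: filterS (nbhs_right_le zij) => r + _; lra.
have [r [r0 rz rzz]] := filter_ex nearr.
have nearh : \forall h \near (0 : R)^'+, [/\ 0 < h,
    forall i : 'I_n, [/\ h <= th i, h <= pi / 2 - th i &
      forall t, `|t - th i| <= h -> `|cos (2 * t) - z i| <= r] &
    forall i j : 'I_n, (i < j)%N -> 2 * h <= th i - th j].
  near=> h; split; first by near: h; exact: nbhs_right_gt.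
    near: h; apply: filter_forall => i; have /andP[th1 th2] := th0 i.
    near=> h; split.
    - by near: h; exact: nbhs_right_le.
    - by near: h; apply: nbhs_right_le; rewrite subr_gt0.
    - near: h; apply: near_right_closed_ball; rewrite -thz; exact: near_cos_double.
  near: h; apply: filter_forall => i; apply: filter_forall => j.
  have [ij|_] := ltnP i j; last exact: nearW.
  have thij : 0 < (th i - th j) / 2 by rewrite mulr_gt0// subr_gt0 tht.
  by apply: filterS (nbhs_right_le thij) => h + _; lra.
have [h [h0 hth hij]] := filter_ex nearh.
exists h => // t tn tbox.
have th_box (i : 'I_n) : th i - h <= nth 0 t i <= th i + h.
  have /andP[? ?] := tbox _ (ltn_ord i); rewrite /th in hth *; apply/andP; split; lra.
have xr (i : 'I_n) : `|cos (2 * nth 0 t i) - z i| <= r.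
  have [_ _ hr] := hth i; apply: hr; have /andP[? ?] := th_box i.
  by rewrite ler_norml; apply/andP; split; lra.
have xr' i (i_n : (i < n)%N) : z i - r <= cos (2 * nth 0 t i) <= z i + r.
  by have := xr (Ordinal i_n); rewrite ler_norml/= => /andP[? ?]; apply/andP; split; lra.
split.
  split=> //; split=> [i i_n|i j].
    have [/= h1 h2 _] := hth (Ordinal i_n); have /andP[/= ? ?] := th_box (Ordinal i_n).
    by apply/andP; split; lra.
  rewrite leq_eqVlt => /predU1P[->//|ij] jn.
  have i_n := ltn_trans ij jn.
  have /andP[/= ? _] := th_box (Ordinal i_n); have /andP[/= _ ?] := th_box (Ordinal jn).
  by have /= := hij (Ordinal i_n) (Ordinal jn) ij; lra.
apply: jacobi_weight_ge => //; rewrite -/q.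
- move=> i i_n; have [/= ? _] := rz (Ordinal i_n); have /andP[? ?] := xr' _ i_n; lra.
- move=> i i_n; have [/= _ ?] := rz (Ordinal i_n); have /andP[? ?] := xr' _ i_n; lra.
- move=> i j ij jn; have i_n := ltn_trans ij jn.
  have /andP[? ?] := xr' _ i_n; have /andP[? ?] := xr' _ jn.
  by have /= := rzz (Ordinal i_n) (Ordinal jn) ij; lra.
Unshelve. all: by end_near. Qed.

(** * Concentration of the law *)

Theorem theorem2p4 (R : realType) (N : nat) (a b : R) (c : R -> R)
  (z : seq R) :
  0 <= a -> 0 < b ->
  (* c kappa > 0 is the normalizing constant of mu~_kappa *)
  (forall kappa : R, 0 < kappa ->
     0 < c kappa /\ trig_law N a b (c kappa) kappa setT = 1%E) ->
  (* z = [:: z_1; ...; z_N] are the ordered zeros of P_N^(a+b-1, b-1) *)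
  size z = N -> sorted <%R z -> all (root (jacobiP N (a + b - 1) (b - 1))) z ->
  (* convergence in probability to (acos z_1 / 2, ..., acos z_N / 2) *)
  forall eps : R, 0 < eps ->
    (trig_law N a b (c kappa) kappa
       [set t | exists2 i, (i < N)%N &
                  eps <= `| nth 0 t i - acos (nth 0 z i) / 2 |])
      @[kappa --> +oo] --> 0%E.
Proof.
move=> a0 b0 cP zN zs zr eps eps0.
have al1 : -1 < a + b - 1 by lra.
have be1 : -1 < b - 1 by lra.
have z1 i : (i < N)%N -> -1 < nth 0 z i < 1.
  move=> i_n; apply: (root_jacobiP_itv al1 be1); apply: (all_nthP 0 zr).
  by rewrite zN.
have zz i j : (i < j)%N -> (j < N)%N -> nth 0 z i < nth 0 z j.
  by move=> ij jn; rewrite lt_sorted_ltn_nth// inE zN// (ltn_trans ij).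
have zS i : (i < N)%N -> \sum_(j < N) (nth 0 z i - nth 0 z j)^-1 =
    (a + b) / 2 / (1 - nth 0 z i) - b / 2 / (1 + nth 0 z i).
  by move=> i_n; rewrite (stieltjes al1 be1 zN (lt_sorted_uniq zs) zr i_n) !subrK.
have V0 : 0 < jacobi_weight N a b (nth 0 z) by exact: jacobi_weight_gt0.
set V := jacobi_weight N a b (nth 0 z) in V0.
have neard : \forall d \near (0 : R)^'+, 0 < d /\ forall (i : 'I_N) t, 0 <= t <= pi / 2 ->
    eps <= `|t - acos (nth 0 z i) / 2| -> d <= `|cos (2 * t) - nth 0 z i|.
  near=> d; split; first by near: d; exact: nbhs_right_gt.
  by near: d; apply: filter_forall => i; apply: near_acos_gap => //; exact: z1.
have [d [d0 dP]] := filter_ex neard.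
(* The gain from one coordinate whose cosine is at least [d] away from its zero. *)
pose l := b / 2 * ln (1 + d ^+ 2 / 16).
have d2 : 0 < d ^+ 2 / 16 by rewrite divr_gt0 ?exprn_gt0.
have l0 : 0 < l by rewrite mulr_gt0 ?divr_gt0// ln_gt0 ?ltrDl.
pose C : R := \sum_(j < N) \sum_(i < j) 1 + \sum_(i < N) (a / 2 + b).
have C0 : 0 <= C.
  apply: addr_ge0; apply: sumr_ge0 => i _; last by lra.
  exact: sumr_ge0.
(* Makes the loss [s * C] on the box at most half the gain; [C + 1] keeps the denominator positive
   even when [C = 0]. *)
pose s := l / 2 / (C + 1).
have s0 : 0 < s by rewrite !divr_gt0//; lra.
have sC : s * C <= l / 2.
  rewrite /s mulrAC ler_pdivrMr; last by lra.
  by rewrite ler_pM2l; lra.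
have [h h0 hP] := exists_alcove_box a0 (ltW b0) s0 z1 zz.
have lower t : size t = N ->
    in_box N (fun i => acos (nth 0 z i) / 2 - h) (2 * h) t ->
    trig_alcove N t /\
    V * expR (- (l / 2)) <= jacobi_weight N a b (fun i => cos (2 * nth 0 t i)).
  move=> tn /(hP _ tn)[At Vt]; split; first exact: At.
  by apply: le_trans Vt; rewrite -/C ler_pM2l// ler_expR mulNr lerN2.
have upper t : trig_alcove N t ->
    (exists2 i, (i < N)%N & eps <= `|nth 0 t i - acos (nth 0 z i) / 2|) ->
    jacobi_weight N a b (fun i => cos (2 * nth 0 t i)) <= V * expR (- l).
  move=> tA [i i_n ei]; have [_ [t1 _]] := tA.
  pose x i := cos (2 * nth 0 t i).
  have x1 j : (j < N)%N -> -1 <= x j <= 1 by rewrite cos_geN1 cos_le1.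
  have xx j k : (j < k)%N -> (k < N)%N -> x j <= x k by exact: trig_alcove_cos_le.
  apply: le_trans (jacobi_weight_le a0 (ltW b0) z1 zz zS x1 xx) _.
  rewrite ler_pM2l// ler_expR lerN2 (bigD1 (Ordinal i_n))//=.
  have q1 y : 1 <= 1 + y ^+ 2 / 16 :> R by rewrite lerDl divr_ge0 ?sqr_ge0.
  rewrite ler_wpDr//.
    by apply: sumr_ge0 => j _; rewrite mulr_ge0 ?ln_ge0 ?q1//; lra.
  rewrite ler_pM2l ?divr_gt0// ler_ln ?posrE ?(lt_le_trans ltr01)// lerD2l.
  rewrite ler_pM2r// -(real_normK (num_real (x i - _))) lerXn2r ?nnegrE ?(ltW d0)//.
  exact: dP (Ordinal i_n) _ (t1 _ i_n) ei.
apply: (@squeeze_cvge _ _ _ _ (fun=> 0%E) _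
  (fun k => ((pi / 2) ^+ N / (2 * h) ^+ N * expR (- (k * (l / 2))))%:E)).
- apply: filterS (nbhs_pinfty_gt (num_real 0)) => k k0.
  have [c0 cN] := cP _ k0; rewrite trig_law_ge0 ?(ltW c0)//=.
  have w0 : 0 < 2 * h by rewrite mulr_gt0.
  have Vk0 : 0 < V `^ k by rewrite powR_gt0.
  have VE e : (V * expR e) `^ k = V `^ k * expR (k * e).
    by rewrite powRM ?expR_ge0 ?(ltW V0)// [k * e]mulrC expRM.
  apply: (le_trans (@trig_law_le _ _ _ _ _ _ (V `^ k * expR (k * - l)) _ _ _ _)).
  + exact: ltW.
  + by rewrite mulr_ge0 ?expR_ge0 ?powR_ge0.
  + move=> t At Et; rewrite trig_densityE// -VE.
    have Ut := upper _ At Et.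
    apply: ge0_ler_powR => //; first exact: ltW.
    * by rewrite nnegrE jacobi_weight_ge0// => i j; exact: trig_alcove_cos_le.
    * by rewrite nnegrE mulr_ge0 ?expR_ge0// ltW.
  have : ((c k * (V `^ k * expR (k * - (l / 2)) * (2 * h) ^+ N))%:E <= 1)%E.
    rewrite -cN; apply: (trig_law_ge _ (l := fun i => acos (nth 0 z i) / 2 - h)) => //.
    * exact: ltW.
    * by rewrite mulr_ge0 ?expR_ge0 ?powR_ge0.
    * move=> t tn tb; have [At Vt] := lower _ tn tb.
      split; first exact: At.
      rewrite (trig_densityE _ _ _ At) -VE.
      have Vl0 : 0 <= V * expR (- (l / 2)) by rewrite mulr_ge0 ?expR_ge0// ltW.
      apply: ge0_ler_powR; [exact: ltW|exact: Vl0|exact: le_trans Vt|exact: Vt].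
  rewrite !lee_fin => cV1.
  (* One half of the exponent is absorbed by the bound on [c k]; the other half gives the decay. *)
  have -> : k * - l = - (k * (l / 2)) + k * - (l / 2) by field.
  rewrite expRD; set e1 := expR (- _); set e2 := expR _ in cV1 *.
  have wN : 0 < (2 * h) ^+ N by rewrite exprn_gt0.
  rewrite mulrA -(ler_pdivlMr _ _ wN) div1r in cV1.
  have -> : c k * (V `^ k * (e1 * e2) * (pi / 2) ^+ N) =
    (c k * (V `^ k * e2)) * (e1 * (pi / 2) ^+ N) by ring.
  have -> : (pi / 2) ^+ N / (2 * h) ^+ N * e1 = ((2 * h) ^+ N)^-1 * (e1 * (pi / 2) ^+ N).
    by ring.
  rewrite ler_wpM2r//.
  by rewrite mulr_ge0 ?expR_ge0// exprn_ge0// divr_ge0// pi_ge0.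
- exact: cvg_cst.
- by apply: cvg_expR_EFin; rewrite divr_gt0.
Unshelve. all: by end_near. Qed.
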